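(* Let $p$ be a prime and let $G$ be a $p$-group of nilpotency class $2$ and exponent $p$. Let $g \in G'$ be such that for some presentation of $g$, the corresponding weighted graph $\Gamma$ has four vertices and is defectless. Then $g \in K(G)$.
   Context: $K(G)$ denotes the set of commutators $\{[a,b]: a,b\in G\}$, $G'$ the commutator subgroup (generated by $K(G)$), and $Z(G)$ the center of $G$. Weighted graphs: a weighted graph over a field $F$ is a finite simple graph $\Gamma=(V,E)$ with ordered vertex set $V=\{v_1,\dots,v_n\}$, where each edge $e_{i,j}$ ($i<j$) joining $v_i$ and $v_j$ carries a weight $d_{i,j}\in F$ (possibly $0$). For an edge between $v_i$ and $v_j$ with $i<j$ put $d(v_i,v_j):=d_{i,j}$ and $d(v_j,v_i):=-d_{i,j}$. Defects of a weighted graph with four vertices: - type $(4)_A$: there are distinct vertices $p_1,p_2,p_3,p_4$ such that $p_1p_2,p_1p_3,p_2p_3,p_3p_4$ are edges, $d(p_1,p_3)=d(p_2,p_3)=0$, $d(p_1,p_2)\neq0$ and $d(p_3,p_4)\ne 0$. - type $(4)_B$: there are distinct vertices $p_1,p_2,p_3,p_4$ such that $p_1p_2,p_1p_3,p_1p_4,p_2p_3,p_3p_4$ are edges, $d(p_1,p_3)=0$, the weights $d(p_1,p_2),d(p_1,p_4),d(p_2,p_3),d(p_3,p_4)$ are all nonzero, and $d(p_1,p_2)d(p_3,p_4)\neq -d(p_1,p_4)d(p_2,p_3)$. - type $(4)_C$: there are distinct vertices $p_1,p_2,p_3,p_4$, all six pairs of which are edges with nonzero weights, and $d(p_1,p_2)d(p_3,p_4)+d(p_1,p_4)d(p_2,p_3)\neq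 d(p_1,p_3)d(p_2,p_4)$. Other edges of $\Gamma$ may be present in addition to the listed ones. The graph is defectless if it has no defect of type $(4)_A$, $(4)_B$ or $(4)_C$. Presentations: let $g_1,g_2,\dots\in G$ be elements (finitely many, $g_1,\dots,g_m$, when $G$ is finite) whose images generate $G/Z(G)$. For $g\in G'$ write $g=\prod_{i<j}[g_i,g_j]^{d_{i,j}}$ as a finite product with $d_{i,j}\in\mathbb Z$ (neither the generating set nor the exponents are unique; commutators are central, so the order of the product is irrelevant). Let $\mathcal I$ be the set of all indices $k$ such that $d_{k,j}\neq 0$ for some $j$ or $d_{i,k}\ne0$ for some $i$, and let $n=|\mathcal I|$. Permute the indices so that $\mathcal I=\{1,\dots,n\}$ (with the convention $d_{j,i}=-d_{i,j}$). The corresponding weighted graph $\Gamma$, over the field $\mathbb F_p$ with $p$ elements, has vertices $v_1,\dots,v_n$; $v_i$ and $v_j$ are adjacent if and only if $[g_i,g_j]\neq1$, and the edge $e_{i,j}$ ($i<j$) has weight $d_{i,j}$ modulo $p$, regarded as an element of $\mathbb F_p$. The weight sequence so obtained (for any choice of generators, exponents and permutation) is called a presentation of $g$, and $\Gamma$ is its corresponding weighted graph. *)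

(* Defs.v *)
From HB Require Import structures.
From mathcomp Require Import all_boot all_order all_fingroup all_algebra.

Set Implicit Arguments.
Unset Strict Implicit.
Unset Printing Implicit Defensive.

Import Order.TTheory GRing.Theory.

Local Open Scope group_scope.

(* Groups are arbitrary, possibly infinite, groupTypes; the predicates of      *)
(* fingroup and solvable only cover finite groups. Subsets are G -> Prop.      *)

Definition is_commutator (G : groupType) (g : G) : Prop :=
  exists a b : G, g = [~ a, b].

Inductive generated (G : groupType) (A : G -> Prop) : G -> Prop :=
| gen_base x of A x : generated A x
| gen_one : generated A 1
| gen_mul x y of generated A x & generated A y : generated A (x * y)
| gen_inv x of generated A x : generated A x^-1.

Definition derived_subgroup (G : groupType) : G -> Prop :=
  generated (@is_commutator G).

Definition in_center (G : groupType) (z : G) : Prop :=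
  forall x : G, commute z x.

(* 0-based: lower_central G 0 is G, lower_central G 1 is G'. *)
Fixpoint lower_central (G : groupType) (k : nat) : G -> Prop :=
  if k is k'.+1 then
    generated (fun z => exists x y : G,
                          lower_central (G := G) k' x /\ z = [~ x, y])
  else fun=> True.

Definition trivial_subgroup (G : groupType) (A : G -> Prop) : Prop :=
  forall x : G, A x -> x = 1.

Definition nilpotency_class (G : groupType) (c : nat) : Prop :=
  trivial_subgroup (lower_central (G := G) c) /\
  (forall k, (k < c)%N -> ~ trivial_subgroup (lower_central (G := G) k)).

Definition is_p_group (p : nat) (G : groupType) : Prop :=
  forall x : G, exists k : nat, x ^+ (p ^ k)%N = 1.

Definition has_exponent (G : groupType) (n : nat) : Prop :=
  [/\ (0 < n)%N,
      forall x : G, x ^+ n = 1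
    & forall m, (0 < m)%N -> (forall x : G, x ^+ m = 1) -> (n <= m)%N].

(* Integer powers; Negz n is the integer - n.+1. *)
Definition expgz (G : groupType) (x : G) (z : int) : G :=
  match z with Posz n => x ^+ n | Negz n => x ^- n.+1 end.

(* Only the values d x y with x < y are data; the others follow from the       *)
(* convention d y x = - d x y.                                                 *)
Definition skew (disp : Order.disp_t) (T : orderType disp) (V : zmodType)
    (d : T -> T -> V) (x y : T) : V :=
  (if (x < y)%O then d x y else if (y < x)%O then - d y x else 0)%R.

(* The value wg_weight i j is meaningful only when i < j and wg_adj i j.       *)
Record wgraph (F : fieldType) (n : nat) : Type := WGraph {
  wg_adj : rel 'I_n;
  wg_adj_sym : symmetric wg_adj;
  wg_adj_irr : irreflexive wg_adj;
  wg_weight : 'I_n -> 'I_n -> F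
}.

Definition wg_d (F : fieldType) (n : nat) (Gamma : wgraph F n) : 'I_n -> 'I_n -> F :=
  skew (wg_weight Gamma).

Section Defects.
Local Open Scope ring_scope.
Variables (F : fieldType) (Gamma : wgraph F 4).
Local Notation e := (wg_adj Gamma).
Local Notation d := (wg_d Gamma).

Definition defect4A : Prop :=
  exists p1 p2 p3 p4 : 'I_4,
    [/\ uniq [:: p1; p2; p3; p4],
        [&& e p1 p2, e p1 p3, e p2 p3 & e p3 p4],
        d p1 p3 = 0 /\ d p2 p3 = 0
      & d p1 p2 != 0 /\ d p3 p4 != 0].

Definition defect4B : Prop :=
  exists p1 p2 p3 p4 : 'I_4,
    [/\ uniq [:: p1; p2; p3; p4],
        [&& e p1 p2, e p1 p3, e p1 p4, e p2 p3 & e p3 p4],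
        d p1 p3 = 0,
        [&& d p1 p2 != 0, d p1 p4 != 0, d p2 p3 != 0 & d p3 p4 != 0]
      & d p1 p2 * d p3 p4 != - (d p1 p4 * d p2 p3)].

Definition defect4C : Prop :=
  exists p1 p2 p3 p4 : 'I_4,
    [/\ uniq [:: p1; p2; p3; p4],
        [&& e p1 p2, e p1 p3, e p1 p4, e p2 p3, e p2 p4 & e p3 p4],
        [&& d p1 p2 != 0, d p1 p3 != 0, d p1 p4 != 0,
            d p2 p3 != 0, d p2 p4 != 0 & d p3 p4 != 0]
      & d p1 p2 * d p3 p4 + d p1 p4 * d p2 p3 != d p1 p3 * d p2 p4].

Definition defectless4 : Prop := [/\ ~ defect4A, ~ defect4B & ~ defect4C].

End Defects.

(* A presentation of g whose index set has n elements. A finite family         *)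
(* g_1, ..., g_m is encoded by padding it with 1. Conversely, as pr_exp has    *)
(* finite support, a sequence can be cut to a finite family when G is finite,  *)
(* without changing the index set or the graph, so no separate finite case is  *)
(* needed. pr_gen_generates says that the cosets of the g_i generate G / Z(G): *)
(* every coset of Z(G) has a representative w in the subgroup generated by the *)
(* g_i. Only the values pr_exp i j with i < j are used.                        *)
Record presentation (G : groupType) (g : G) (n : nat) : Type := Presentation {
  pr_gen : nat -> G;
  pr_gen_generates : forall h : G,
    exists2 w : G, generated (fun x => exists i, x = pr_gen i) w
                 & in_center (w^-1 * h);
  pr_exp : nat -> nat -> int;
  pr_bound : nat;
  pr_exp_finite : forall i j,
    (i < j)%N -> pr_exp i j != 0%R -> (j < pr_bound)%N;
  pr_prod : g = \prod_(j < pr_bound) \prod_(i < j)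
                  expgz [~ pr_gen i, pr_gen j] (pr_exp i j);
  pr_index : 'I_n -> nat;
  pr_index_inj : injective pr_index;
  pr_index_image : forall k : nat,
    (exists u, pr_index u = k) <->
    ((exists2 j, (k < j)%N & pr_exp k j != 0%R) \/
     (exists2 i, (i < k)%N & pr_exp i k != 0%R))
}.

Section PresentationGraph.
Variables (p : nat) (G : groupType) (g : G) (n : nat) (P : presentation g n).

Definition pres_adj : rel 'I_n :=
  fun u v => [~ pr_gen P (pr_index P u), pr_gen P (pr_index P v)] != 1.

Lemma pres_adj_sym : symmetric pres_adj.
Proof. by move=> u v; rewrite /pres_adj -[in LHS]invg_comm invg_eq1. Qed.

Lemma pres_adj_irr : irreflexive pres_adj.
Proof. by move=> u; rewrite /pres_adj commgg eqxx. Qed.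

Definition pres_weight (u v : 'I_n) : 'F_p :=
  (skew (pr_exp P) (pr_index P u) (pr_index P v))%:~R%R.

Definition pres_graph : wgraph 'F_p n :=
  WGraph pres_adj_sym pres_adj_irr pres_weight.

End PresentationGraph.

(* Main.v *)
(* Over F_p, the commutator map is an alternating form on the span of the four
   generators, and g is the value of the weight bivector. Non-adjacent generators
   commute, so weights on non-edges can be changed freely, and it suffices to make the
   Pfaffian vanish: a 4 x 4 skew matrix with zero Pfaffian is a decomposable bivector
   (a b^T - b a^T), and then g = [prod x_i^a_i, prod x_i^b_i]. If some non-edge is
   opposite to a pair of nonzero (or freely chosen) weight, one linear equation is
   solved for it; otherwise the defects A, B, C are exactly the ways in which the
   Pfaffian can fail to vanish. *)
Require Import Defs.
From HB Require Import structures.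
From mathcomp Require Import all_boot all_order all_fingroup all_algebra.
From mathcomp Require Import boolp ring.

Set Implicit Arguments.
Unset Strict Implicit.
Unset Printing Implicit Defensive.

Import Order.TTheory GRing.Theory.

Local Open Scope ring_scope.

(** * Four-by-four skew matrices: Pfaffian and decomposability *)

Definition skew_symmetric (T : Type) (V : zmodType) (d : T -> T -> V) : Prop :=
  (forall u, d u u = 0) /\ (forall u v, d u v = - d v u).

Lemma skewP (disp : Order.disp_t) (T : orderType disp) (V : zmodType) (d : T -> T -> V) :
  skew_symmetric (Defs.skew d).
Proof.
split=> [u|u v]; rewrite /Defs.skew ?ltxx //.
by case: ltgtP => // _; rewrite ?opprK ?oppr0.
Qed.

Definition pfaffian (T : Type) (R : pzRingType) (d : T -> T -> R) (i j k l : T) : R :=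
  d i j * d k l - d i k * d j l + d i l * d j k.

Lemma ord4_cases (i j k l u : 'I_4) :
  uniq [:: i; j; k; l] -> [\/ u = i, u = j, u = k | u = l].
Proof.
move=> q; have : u \in [:: i; j; k; l].
  have [||_ ->] := uniq_min_size q (s2 := enum 'I_4); rewrite ?mem_enum //.
    by move=> x _; rewrite mem_enum.
  by rewrite size_enum_ord.
by rewrite !inE => /or4P[]/eqP->; [constructor 1|constructor 2|constructor 3|constructor 4].
Qed.

(** The Pfaffian is alternating, so any other choice of indices gives 0 or the given value up to
    sign. *)
Lemma pfaffian0_pluecker (R : comPzRingType) (d : 'I_4 -> 'I_4 -> R) (i j k l : 'I_4) :
  skew_symmetric d -> uniq [:: i; j; k; l] -> pfaffian d i j k l = 0 ->
  forall a b u v, pfaffian d a b u v = 0.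
Proof.
move=> [d0 dN] q; rewrite /pfaffian => pf a b u v.
have dE := (d0 i, d0 j, d0 k, d0 l, dN j i, dN k i, dN l i, dN k j,
            dN l j, dN l k).
by case: (ord4_cases a q) => ->; case: (ord4_cases b q) => ->;
  case: (ord4_cases u q) => ->; case: (ord4_cases v q) => ->;
  rewrite ?dE; first [ring | rewrite -[RHS]pf; ring | rewrite -oppr0 -[in RHS]pf; ring].
Qed.

Lemma pfaffian0_decomposable (F : fieldType) (d : 'I_4 -> 'I_4 -> F) (i j k l : 'I_4) :
  skew_symmetric d -> uniq [:: i; j; k; l] -> pfaffian d i j k l = 0 ->
  exists a b : 'I_4 -> F, forall u v, d u v = a u * b v - a v * b u.
Proof.
move=> sd q pf; have pl := pfaffian0_pluecker sd q pf; have [d0 dN] := sd.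
have [/existsP[s /existsP[t nz]]|/existsPn z] := boolP [exists s, exists t, d s t != 0].
  (* The Pluecker relations: w = (i_s w /\ i_t w) / w(s,t). *)
  exists (fun u => d s u / d s t), (fun v => d t v) => u v.
  apply: (mulfI nz); move: (pl s t u v); rewrite /pfaffian => /eqP.
  rewrite -addrA addr_eq0 opprD opprK => /eqP->.
  by field.
exists (fun=> 0), (fun=> 0) => u v; rewrite !mul0r subr0.
by have /existsPn/(_ v) := z u; rewrite negbK => /eqP.
Qed.

(** The two vertex lists have the same counting function, which [ring] checks. *)
Local Ltac reorder q :=
  apply: etrans q; apply: perm_uniq; apply/seq.permP => ? /=; ring.

(** * Completing the weights of a defectless graph *)

Section Defectless.
Variables (F : fieldType) (Gamma : wgraph F 4).
Local Notation e := (wg_adj Gamma).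
Local Notation d := (wg_d Gamma).

(* Weight 1 on the non-edges makes every zero of the completion an edge. *)
Definition unit_completion (u v : 'I_4) : F :=
  if e u v then d u v else Defs.skew (fun _ _ => 1) u v.

Local Notation d1 := unit_completion.

Lemma unit_completion_skew : skew_symmetric d1.
Proof.
rewrite /d1; split=> [u|u v].
  by rewrite wg_adj_irr; apply: (skewP _).1.
by rewrite wg_adj_sym; case: ifP => _; apply: (skewP _).2.
Qed.

Lemma unit_completion_edge u v : u != v -> d1 u v = 0 -> e u v.
Proof.
rewrite /d1; case: ifP => // _; rewrite /Defs.skew.
by case: ltgtP => // _ _ /eqP; rewrite ?oppr_eq0 oner_eq0.
Qed.

Lemma unit_completionE u v : e u v -> d1 u v = d u v.
Proof. by rewrite /d1 => ->. Qed.

Hypothesis dl : defectless4 Gamma.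
(* The case in which no non-edge weight can be used to adjust the Pfaffian. *)
Hypothesis rigid : forall i j k l : 'I_4,
  uniq [:: i; j; k; l] -> ~~ e i j -> d1 k l = 0.

(** By [rigid], a non-edge in one pair would annihilate the weight of the opposite pair. *)
Lemma rigid_edges i j k l : uniq [:: i; j; k; l] -> d1 i j * d1 k l != 0 -> e i j && e k l.
Proof.
move=> q; rewrite mulf_eq0 negb_or => /andP[ij kl].
have q' : uniq [:: k; l; i; j] by reorder q.
apply/andP; split; [apply: contraR kl => n|apply: contraR ij => n]; apply/eqP.
  exact: rigid q n.
exact: rigid q' n.
Qed.

(** Were the product nonzero, both of its pairs would be edges; the two zeros are edges as well,
    which is a defect of type A. *)
Lemma rigid_not_defect4A i j k l : uniq [:: i; j; k; l] ->
  d1 i k = 0 -> d1 j k = 0 -> d1 i j * d1 k l = 0.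
Proof.
move=> q ik jk; apply/eqP/negPn/negP => nz.
have /andP[eij ekl] := rigid_edges q nz.
move: (q) => /=; rewrite !inE !negb_or => /and4P[/and3P[_ nik _] /andP[njk _] _ _].
have eik := unit_completion_edge nik ik; have ejk := unit_completion_edge njk jk.
have [+ _ _] := dl; apply; exists i, j, k, l; split=> //.
- by rewrite eij eik ejk ekl.
- by rewrite -!unit_completionE.
by apply/andP; move: nz; rewrite mulf_eq0 negb_or !unit_completionE.
Qed.

(** This is the vanishing of the Pfaffian when its [i k] entry is zero. *)
Lemma rigid_not_defect4B i j k l : uniq [:: i; j; k; l] ->
  d1 i k = 0 -> d1 i j * d1 k l = - (d1 i l * d1 j k).
Proof.
move=> q ik; have [d0 dN] := unit_completion_skew.
have ki : d1 k i = 0 by rewrite dN ik oppr0.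
(* A second zero shares a vertex with [i k]; the type A lemma with that vertex in third place kills
   the other product. *)
have A1 : d1 i j = 0 -> d1 i l * d1 j k = 0.
  move=> ij; have ji : d1 j i = 0 by rewrite dN ij oppr0.
  rewrite mulrC; apply: (@rigid_not_defect4A j k i l) => //.
  by reorder q.
have A2 : d1 k l = 0 -> d1 i l * d1 j k = 0.
  move=> kl; have lk : d1 l k = 0 by rewrite dN kl oppr0.
  rewrite [d1 j k]dN mulrN; apply/eqP; rewrite oppr_eq0; apply/eqP.
  apply: (@rigid_not_defect4A i l k j) => //.
  by reorder q.
have A3 : d1 i l = 0 -> d1 i j * d1 k l = 0.
  move=> il; have li : d1 l i = 0 by rewrite dN il oppr0.
  rewrite mulrC; apply: (@rigid_not_defect4A k l i j) => //.
  by reorder q.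
have A4 : d1 j k = 0 -> d1 i j * d1 k l = 0 by exact: rigid_not_defect4A.
have [ij|nij] := eqVneq (d1 i j) 0; first by rewrite A1 // ij mul0r oppr0.
have [kl|nkl] := eqVneq (d1 k l) 0; first by rewrite A2 // kl mulr0 oppr0.
have [il|nil] := eqVneq (d1 i l) 0; first by rewrite A3 // il mul0r oppr0.
have [jk|njk] := eqVneq (d1 j k) 0; first by rewrite A4 // jk mulr0 oppr0.
have /andP[eij ekl] : e i j && e k l by apply: rigid_edges q _; rewrite mulf_neq0.
have /andP[eil ejk] : e i l && e j k.
  apply: rigid_edges; last by rewrite mulf_neq0.
  by reorder q.
have eik : e i k.
  by apply: unit_completion_edge ik; move: q => /=; rewrite !inE !negb_or => /and4P[/and3P[]].
apply/eqP/negPn/negP; rewrite !unit_completionE // => ne.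
have [_ + _] := dl; apply; exists i, j, k, l; split=> //.
- by rewrite eij eik eil ejk ekl.
- by rewrite -unit_completionE.
by rewrite -!unit_completionE // nij nkl nil njk.
Qed.

(** Relabelling moves any zero weight to the first and third vertices, where [rigid_not_defect4B]
    applies; if all six are nonzero, all pairs are edges and type C is excluded. *)
Lemma rigid_pfaffian0 i j k l : uniq [:: i; j; k; l] -> pfaffian d1 i j k l = 0.
Proof.
move=> q; have [d0 dN] := unit_completion_skew.
rewrite /pfaffian.
have [ik|nik] := eqVneq (d1 i k) 0.
  by rewrite (rigid_not_defect4B q ik) ik mul0r subr0 addNr.
have [jl|njl] := eqVneq (d1 j l) 0.
  have := @rigid_not_defect4B j i l k; rewrite jl mulr0 subr0.
  rewrite [d1 j i]dN [d1 l k]dN mulrNN [d1 j k * _]mulrC.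
  by move=> ->; rewrite ?addNr //; reorder q.
have [ij|nij] := eqVneq (d1 i j) 0.
  have := @rigid_not_defect4B i k j l; rewrite ij mul0r sub0r [d1 k j]dN mulrN opprK.
  by move=> ->; rewrite ?addNr //; reorder q.
have [kl|nkl] := eqVneq (d1 k l) 0.
  have := @rigid_not_defect4B k i l j; rewrite kl mulr0 sub0r.
  rewrite [d1 k i]dN [d1 l j]dN mulrNN [d1 k j]dN mulNr opprK [d1 j k * _]mulrC.
  by move=> ->; rewrite ?addNr //; reorder q.
have [il|nil] := eqVneq (d1 i l) 0.
  have := @rigid_not_defect4B i j l k; rewrite il mul0r addr0 [d1 l k]dN mulrN => H.
  by rewrite (oppr_inj (H _ (erefl _))) ?subrr //; reorder q.
have [jk|njk] := eqVneq (d1 j k) 0.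
  have := @rigid_not_defect4B j i k l; rewrite jk mulr0 addr0.
  rewrite [d1 j i]dN mulNr [d1 j l * _]mulrC => H.
  by rewrite (oppr_inj (H _ (erefl _))) ?subrr //; reorder q.
have /andP[eij ekl] : e i j && e k l by apply: rigid_edges q _; rewrite mulf_neq0.
have /andP[eik ejl] : e i k && e j l.
  apply: rigid_edges; last by rewrite mulf_neq0.
  by reorder q.
have /andP[eil ejk] : e i l && e j k.
  apply: rigid_edges; last by rewrite mulf_neq0.
  by reorder q.
apply/eqP/negPn/negP; rewrite addrAC subr_eq0 !unit_completionE // => ne.
have [_ _] := dl; apply; exists i, j, k, l; split=> //.
  by rewrite eij eik eil ejk ejl ekl.
by rewrite -!unit_completionE // nij nik nil njk njl nkl.
Qed.

End Defectless.

Lemma defectless_completion (F : fieldType) (Gamma : wgraph F 4) : defectless4 Gamma ->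
  exists a b : 'I_4 -> F,
    forall u v, wg_adj Gamma u v -> wg_d Gamma u v = a u * b v - a v * b u.
Proof.
move=> dl; pose d1 := unit_completion Gamma.
have [d0 dN] : skew_symmetric d1 := unit_completion_skew Gamma.
(* The Pfaffian is affine in the entry [i j] with slope [d1 k l]: either a non-edge has nonzero
   slope, or the graph is rigid. *)
have [[i [j [k [l [q nij nkl]]]]]|rigid] :=
    EM (exists i j k l : 'I_4, [/\ uniq [:: i; j; k; l], ~~ wg_adj Gamma i j & d1 k l != 0]);
  last first.
  have q : uniq [:: 0; 1; 2%:R; 3%:R : 'I_4] by [].
  have pf : pfaffian d1 0 1 2%:R 3%:R = 0.
    apply: rigid_pfaffian0 q => // i j k l q nij.
    by apply/eqP/negPn/negP => nz; apply: rigid; exists i, j, k, l.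
  have [a [b ab]] := pfaffian0_decomposable (conj d0 dN) q pf.
  by exists a, b => u v uv; rewrite -ab [RHS]unit_completionE.
(* The value of the (i, j) entry that makes the Pfaffian vanish. *)
pose c := (d1 i k * d1 j l - d1 i l * d1 j k) / d1 k l.
pose d2 u v := if (u == i) && (v == j) then c
               else if (u == j) && (v == i) then - c else d1 u v.
move: (q) => /=; rewrite !inE !negb_or !andbT => /and3P[/and3P[nij' nik nil] /andP[njk njl] nkl'].
have sd2 : skew_symmetric d2.
  split=> [u|u v]; rewrite /d2.
    by have [->|] := eqVneq u i; rewrite ?(negPf nij') //= andbF.
  rewrite [(v == i) && _]andbC [(v == j) && _]andbC.
  have [/andP[/eqP-> _]|_] := boolP ((u == i) && _); first by rewrite (negPf nij') opprK.
  by case: ifP => _; rewrite -?dN.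
have pf : pfaffian d2 i j k l = 0.
  (* Apart from [d2 i j], the entries in this Pfaffian have second index [k] or [l] and are
     unchanged. *)
  have d2E u v : v != i -> v != j -> d2 u v = d1 u v.
    by rewrite /d2 => /negPf-> /negPf->; rewrite !andbF.
  rewrite /pfaffian !(d2E _ k) ?(d2E _ l) 1?eq_sym // /d2 !eqxx /= /c mulfVK //.
  by ring.
have [a [b ab]] := pfaffian0_decomposable sd2 q pf.
exists a, b => u v uv; rewrite -ab /d2.
(* Only the non-edge [i j] was altered, so edges keep their weights. *)
case: ifP => [/andP[/eqP ui /eqP vj]|_]; first by rewrite -ui -vj uv in nij.
case: ifP => [/andP[/eqP uj /eqP vi]|_]; first by rewrite -uj -vi wg_adj_sym uv in nij.
by rewrite [RHS]unit_completionE.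
Qed.

(* Omega_1(Z(G)); (Zp_trunc (pdiv p)).+2 is the cardinal of 'F_p whatever p is, so that
   the F_p-module structure is unconditional; for p prime it is p (Fp_cast). *)
Definition omega1_center (p : nat) (G : groupType) :=
  {z : G | `[< in_center z >] && (z ^+ (Zp_trunc (pdiv p)).+2 == 1)%g}.

(** * The vector space structure of [omega1_center] over ['F_p] *)

Section Omega1Center.
Variables (p : nat) (G : groupType).
Local Notation q := (Zp_trunc (pdiv p)).+2.
Local Notation Z := (omega1_center p G).
Implicit Types (x y z : Z) (a b : 'F_p).

HB.instance Definition _ := [Choice of Z by <:].

Lemma omega1_central z (h : G) : commute (val z) h.
Proof. by case: z => z /= /andP[/asboolP cz _]; exact: cz. Qed.

Lemma omega1_exp z : (val z ^+ q = 1)%g.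
Proof. by case: z => z /= /andP[_ /eqP]. Qed.

Lemma omega1_proof (h : G) : in_center h -> (h ^+ q = 1)%g ->
  `[< in_center h >] && (h ^+ q == 1)%g.
Proof. by move=> ch ->; rewrite eqxx andbT; apply/asboolP. Qed.

Lemma in_center_mul (h k : G) : in_center h -> in_center k -> in_center (h * k)%g.
Proof.
by move=> ch ck l; apply/commute_sym/commuteM; apply/commute_sym; [exact: ch|exact: ck].
Qed.

Lemma in_centerX (h : G) n : in_center h -> in_center (h ^+ n)%g.
Proof. by move=> ch l; apply/commute_sym/commuteX/commute_sym/ch. Qed.

Lemma in_centerV (h : G) : in_center h -> in_center (h^-1)%g.
Proof. by move=> ch l; apply/commute_sym/commuteV/commute_sym/ch. Qed.

Definition omega1_zero : Z :=
  Sub 1%g (omega1_proof (fun h => commute_sym (commute1 h)) (expg1n _ _)).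

(** Ended by [Defined], like the next two, so that [val] computes to the group operation. *)
Definition omega1_opp z : Z.
Proof.
exists (val z)^-1%g; apply: omega1_proof; first exact/in_centerV/omega1_central.
by rewrite expVgn omega1_exp invg1.
Defined.

Definition omega1_add x y : Z.
Proof.
exists (val x * val y)%g; apply: omega1_proof.
  by apply: in_center_mul; exact: omega1_central.
by rewrite expgMn ?omega1_exp ?mulg1 //; exact: omega1_central.
Defined.

Definition omega1_scale a z : Z.
Proof.
exists (val z ^+ a)%g; apply: omega1_proof; first exact/in_centerX/omega1_central.
by rewrite expgnAC omega1_exp expg1n.
Defined.

Fact omega1_addA : associative omega1_add.
Proof. by move=> x y z; apply: val_inj; exact: mulgA. Qed.

Fact omega1_addC : commutative omega1_add.
Proof. by move=> x y; apply: val_inj; exact: omega1_central. Qed.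

Fact omega1_add0 : left_id omega1_zero omega1_add.
Proof. by move=> x; apply: val_inj; exact: mul1g. Qed.

Fact omega1_addN : left_inverse omega1_zero omega1_opp omega1_add.
Proof. by move=> x; apply: val_inj; exact: mulVg. Qed.

HB.instance Definition _ :=
  GRing.isZmodule.Build Z omega1_addA omega1_addC omega1_add0 omega1_addN.

(** Needed since arithmetic in ['F_p] reduces exponents modulo [q]. *)
Lemma omega1_exp_mod z n : (val z ^+ (n %% q) = val z ^+ n)%g.
Proof.
by rewrite [in RHS](divn_eq n q) expgnDr mulnC expgnA omega1_exp expg1n mul1g.
Qed.

Fact omega1_scaleA a b z :
  omega1_scale a (omega1_scale b z) = omega1_scale (a * b) z.
Proof.
apply: val_inj; rewrite /= omega1_exp_mod.
by rewrite expgnA expgnAC.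
Qed.

Fact omega1_scale1 : left_id 1 omega1_scale.
Proof. by move=> z; apply: val_inj. Qed.

Fact omega1_scaleDr : right_distributive omega1_scale +%R.
Proof. by move=> a x y; apply: val_inj; apply: expgMn; exact: omega1_central. Qed.

Fact omega1_scaleDl z : {morph omega1_scale^~ z : a b / a + b}.
Proof.
move=> a b; apply: val_inj; rewrite /= omega1_exp_mod.
by rewrite expgnDr.
Qed.

HB.instance Definition _ := GRing.Zmodule_isLmodule.Build 'F_p Z
  omega1_scaleA omega1_scale1 omega1_scaleDr omega1_scaleDl.

Lemma val_omega1_0 : val (0 : Z) = 1%g. Proof. by []. Qed.

Lemma val_omega1D x y : val (x + y) = (val x * val y)%g. Proof. by []. Qed.

Lemma val_omega1_sum I (r : seq I) (P : pred I) (F : I -> Z) :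
  val (\sum_(i <- r | P i) F i) = (\prod_(i <- r | P i) val (F i))%g.
Proof. exact: (big_morph val val_omega1D val_omega1_0). Qed.

(** Translates the integer exponents of a presentation into scalars. *)
Lemma val_omega1Z_int z (n : int) : val (n%:~R *: z : Z) = expgz (val z) n.
Proof.
have nat_scale k : val (k%:R *: z : Z) = (val z ^+ k)%g.
  rewrite scaler_nat; elim: k => [|k IH] //.
  by rewrite mulrS val_omega1D IH expgS.
case: n => n; first exact: nat_scale.
rewrite NegzE mulrNz scaleNr.
exact: (congr1 (fun h => h^-1)%g (nat_scale n.+1)).
Qed.

End Omega1Center.

(** * Sums over ordered pairs of indices *)

Section AlternatingSums.
Variables (R : pzRingType) (V : lmodType R) (n : nat).
Implicit Types (B : 'I_n -> 'I_n -> V) (c : 'I_n -> 'I_n -> R).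

(** The diagonal vanishes and the lower triangle folds onto the upper one with a sign. *)
Lemma sum_alternating B c : skew_symmetric B ->
  \sum_u \sum_v c u v *: B u v =
  \sum_(q : 'I_n * 'I_n | (q.1 < q.2)%N) (c q.1 q.2 - c q.2 q.1) *: B q.1 q.2.
Proof.
move=> [B0 BN]; rewrite pair_bigA /= (bigID (fun q : 'I_n * 'I_n => (q.1 < q.2)%N)) /=.
under [RHS]eq_bigr do rewrite scalerBl.
rewrite big_split /=; congr (_ + _).
rewrite (bigID (fun q : 'I_n * 'I_n => q.1 == q.2)) /= big1 ?add0r; last first.
  by move=> [u v] /= /andP[_ /eqP->]; rewrite B0 scaler0.
rewrite (reindex_inj (inv_inj (f := fun q : 'I_n * 'I_n => (q.2, q.1)) _)) /=; last by case.
apply: eq_big => [[u v]|[u v] _] /=; last by rewrite BN scalerN.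
by rewrite -leqNgt [RHS]ltn_neqAle andbC eq_sym (inj_eq (@ord_inj n)).
Qed.

(** Either side counts each unordered pair once. It serves for [pr_index], which need not be
    increasing. *)
Lemma sum_symmetric_reorder B (f : 'I_n -> nat) :
  injective f -> (forall u v, B u v = B v u) ->
  \sum_(q : 'I_n * 'I_n | (f q.1 < f q.2)%N) B q.1 q.2 =
  \sum_(q : 'I_n * 'I_n | (q.1 < q.2)%N) B q.1 q.2.
Proof.
move=> f_inj BC.
rewrite (bigID (fun q : 'I_n * 'I_n => (q.1 < q.2)%N)) /=
  [RHS](bigID (fun q : 'I_n * 'I_n => (f q.1 < f q.2)%N)) /=.
congr (_ + _); first by apply: eq_bigl => q; rewrite andbC.
(* Pairs on which the two orders disagree are matched by swapping coordinates. *)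
rewrite (reindex_inj (inv_inj (f := fun q : 'I_n * 'I_n => (q.2, q.1)) _)) /=; last by case.
apply: eq_big => [[u v]|[u v] _] /=; last by rewrite BC.
have [->|uv] := eqVneq u v; first by rewrite !ltnn.
have : u != v :> nat by rewrite (inj_eq (@ord_inj n)).
have : f u != f v by rewrite (inj_eq f_inj).
by case: (ltngtP (f u) (f v)); case: (ltngtP u v).
Qed.

End AlternatingSums.

(** * The commutator as an alternating form over ['F_p] *)

Section Class2.
Variables (p : nat) (G : groupType).
Hypotheses (p_prime : prime p) (expG : forall x : G, (x ^+ p = 1)%g)
  (classG : forall x y : G, in_center [~ x, y]%g).
Local Notation Z := (omega1_center p G).

(** Under the hypotheses of the section the default [0] is never taken: commutators are central and
    have trivial [p]-th power. *)
Definition omega1_comm (x y : G) : Z := insubd (0 : Z) [~ x, y]%g.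

Lemma val_omega1_comm x y : val (omega1_comm x y) = [~ x, y]%g.
Proof.
by apply: insubdK; apply: omega1_proof; [exact: classG|rewrite Fp_cast].
Qed.

Lemma omega1_comm_skew (I : Type) (x : I -> G) :
  skew_symmetric (fun i j => omega1_comm (x i) (x j)).
Proof.
split=> [i|i j]; apply: val_inj; rewrite ?val_omega1_comm ?commgg //.
rewrite -invgR -val_omega1_comm //.
Qed.

Lemma omega1_commMl x y z : omega1_comm (x * y)%g z = omega1_comm x z + omega1_comm y z.
Proof.
apply: val_inj; rewrite val_omega1D !val_omega1_comm.
have -> : [~ x * y, z]%g = ([~ x, z] ^ y * [~ y, z])%g.
  by rewrite !commgEl conjMg (conjgE _ y) invgM !mulgA !mulgK.
by rewrite (conjgE [~ x, z]%g) (classG x z y) mulKg.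
Qed.

Lemma omega1_comm1l z : omega1_comm 1 z = 0.
Proof. by apply: val_inj; rewrite val_omega1_comm comm1g. Qed.

Lemma omega1_commXl x z n : omega1_comm (x ^+ n)%g z = n%:R *: omega1_comm x z.
Proof.
elim: n => [|n IH]; first by rewrite expg0 omega1_comm1l scale0r.
by rewrite expgS omega1_commMl IH [n.+1%:R]mulrS scalerDl scale1r.
Qed.

Lemma omega1_comm_prodl n (x : 'I_n -> G) (a : 'I_n -> 'F_p) z :
  omega1_comm (\prod_i x i ^+ a i)%g z = \sum_i a i *: omega1_comm (x i) z.
Proof.
rewrite (big_morph (omega1_comm^~ z) (fun x y => omega1_commMl x y z) (omega1_comm1l z)).
by apply: eq_bigr => i _; rewrite omega1_commXl natr_Zp.
Qed.

(** Bilinear expansion; the coefficients are the coordinates of the decomposable bivector of [a] and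
    [b]. *)
Lemma omega1_comm_prod n (x : 'I_n -> G) (a b : 'I_n -> 'F_p) :
  omega1_comm (\prod_i x i ^+ a i)%g (\prod_i x i ^+ b i)%g =
  \sum_(q : 'I_n * 'I_n | (q.1 < q.2)%N)
    (a q.1 * b q.2 - a q.2 * b q.1) *: omega1_comm (x q.1) (x q.2).
Proof.
have commN y z : omega1_comm y z = - omega1_comm z y.
  exact: (omega1_comm_skew id).2.
rewrite -(sum_alternating (fun u v => a u * b v) (omega1_comm_skew x)) omega1_comm_prodl.
apply: eq_bigr => i _; rewrite commN omega1_comm_prodl -sumrN scaler_sumr.
by apply: eq_bigr => j _; rewrite -scalerN -commN scalerA.
Qed.

(** Pairs of generators not coming from two vertices have exponent 0, so the product reduces to the
    pairs of vertices. *)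
Lemma presentation_sum (g : G) (n : nat) (P : presentation g n) :
  g = val (\sum_(q : 'I_n * 'I_n | (q.1 < q.2)%N) pres_weight p P q.1 q.2 *:
         omega1_comm (pr_gen P (pr_index P q.1)) (pr_gen P (pr_index P q.2))).
Proof.
pose N := pr_bound P; pose f := pr_index P; pose e := pr_exp P.
(* Exponent and form change sign together, so [E] is symmetric. *)
pose E i j := (Defs.skew e i j)%:~R *: omega1_comm (pr_gen P i) (pr_gen P j).
have skewE i j : (i < j)%N -> Defs.skew e i j = e i j.
  by move=> ij; rewrite /Defs.skew ltEnat /= ij.
have EC i j : E i j = E j i.
  rewrite /E (skewP e).2 (omega1_comm_skew (pr_gen P)).2.
  by rewrite mulrNz scaleNr scalerN opprK.
have fN u : (f u < N)%N.
  have [/(_ (ex_intro _ u erefl)) + _] := pr_index_image P (f u).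
  case=> [[j uj nz]|[i iu nz]]; last exact: pr_exp_finite nz.
  exact: ltn_trans uj (pr_exp_finite uj nz).
pose h u := Ordinal (fN u).
have f_inj : injective f := @pr_index_inj _ _ _ P.
rewrite -(sum_symmetric_reorder f_inj (B := fun u v => E (f u) (f v))) //.
rewrite [LHS](pr_prod P).
transitivity (val (\sum_(j < N) \sum_(i < j) E i j)).
  rewrite val_omega1_sum; apply: eq_bigr => j _; rewrite val_omega1_sum.
  apply: eq_bigr => i _; rewrite /E skewE ?ltn_ord //.
  by rewrite val_omega1Z_int val_omega1_comm.
congr val.
transitivity (\sum_(q : 'I_N * 'I_N | (q.1 < q.2)%N) E q.1 q.2).
  under eq_bigr => j _ do rewrite (big_ord_widen N (fun i => E i j) (ltnW (ltn_ord j))).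
  rewrite (exchange_big_dep predT) //= pair_big_dep /=.
  by apply: eq_bigl.
pose A := [set q : 'I_n * 'I_n | (f q.1 < f q.2)%N].
transitivity (\sum_(q in [set (h u.1, h u.2) | u in A]) E q.1 q.2); last first.
  rewrite big_imset /=; last by move=> [a b] [c d] _ _ [] /f_inj-> /f_inj->.
  by apply: eq_bigl => q; rewrite inE.
rewrite [LHS]big_mkcond [RHS]big_mkcond; apply: eq_bigr => -[i j] _ /=.
have [/imsetP[[u v] + [-> ->]]|nim] := boolP (_ \in _); first by rewrite inE => ->.
case: ifP => // ij; rewrite /E skewE //.
have [->|nz] := eqVneq (e i j) 0; first by rewrite mulr0z scale0r.
(* A nonzero exponent makes [i] and [j] values of [pr_index], so the pair would lie in the image. *)
have [_ /(_ (or_introl (ex_intro2 _ _ (j : nat) ij nz))) [u fu]] := pr_index_image P i.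
have [_ /(_ (or_intror (ex_intro2 _ _ (i : nat) ij nz))) [v fv]] := pr_index_image P j.
case/imsetP: nim; exists (u, v); first by rewrite inE /= /f fu fv.
by congr (_, _); apply: val_inj.
Qed.

End Class2.

(** * Centrality of commutators and the conclusion *)

Lemma class2_central (G : groupType) : nilpotency_class G 2 ->
  forall x y : G, in_center [~ x, y]%g.
Proof.
(* Counting from 0, [lower_central] at 2 is the third term of the series and contains [[x, y],
   z]. *)
move=> [triv _] x y z; apply/commgP/eqP; apply: triv.
apply: gen_base; exists [~ x, y]%g, z; split=> //.
by apply: gen_base; exists x, y.
Qed.

Theorem theorem1p4 (p : nat) (G : groupType) (g : G) :
  prime p ->
  is_p_group p G -> nilpotency_class G 2 -> has_exponent G p ->
  derived_subgroup g ->
  (exists P : presentation g 4, defectless4 (pres_graph p P)) ->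
  is_commutator g.
Proof.
move=> p_prime _ /class2_central classG [_ expG _] _ [P dl].
have [a [b ab]] := defectless_completion dl.
pose x u := pr_gen P (pr_index P u).
exists (\prod_u x u ^+ a u)%g, (\prod_u x u ^+ b u)%g.
rewrite -(val_omega1_comm p_prime expG classG) omega1_comm_prod //.
rewrite [LHS](presentation_sum p_prime expG classG P); congr val.
apply: eq_bigr => -[u v] /= uv.
(* At a non-edge the coefficients may differ, but the form vanishes. *)
have [/eqP c1|uv_edge] := boolP ([~ x u, x v]%g == 1%g).
  suff -> : omega1_comm p (x u) (x v) = 0 by rewrite !scaler0.
  by apply: val_inj; rewrite val_omega1_comm.
by rewrite -ab // /wg_d /Defs.skew ltEord uv.
Qed.
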